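(* There is an absolute constant $c>0$ such that the following holds. Let $\alpha\in[0,1)$ be irrational, let $M$ be a positive integer, and let $k$ be such that $q_k\le M<q_{k+1}$, where $p_j/q_j$ denotes the $j$-th convergent of $\alpha$. Then $$S_M(\alpha)=\sum_{m=1}^M\frac1{\|m\alpha\|}\ \ge\ c\,M\log q_k.$$
   Context: For real $x$, $\|x\|=\min_{n\in\mathbf Z}|x-n|$. For $\alpha\in[0,1)$ irrational, write $\alpha=[a_1,a_2,\dots]=\cfrac{1}{a_1+\cfrac{1}{a_2+\cdots}}$ with positive integers $a_i$; the $j$-th convergent is $p_j/q_j=[a_1,\dots,a_j]$ in lowest terms, with $q_0=1$, $q_1=a_1$, $q_j=a_jq_{j-1}+q_{j-2}$ for $j\ge2$. *)

(* Defs.v *)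
From HB Require Import structures.
From mathcomp Require Import all_boot all_order all_algebra.
From mathcomp Require Import all_classical all_reals all_analysis.
From mathcomp Require Import ring lra zify.

Set Implicit Arguments.
Unset Strict Implicit.
Unset Printing Implicit Defensive.

Import Order.TTheory GRing.Theory Num.Theory.
Import numFieldNormedType.Exports.

Local Open Scope classical_set_scope.
Local Open Scope ring_scope.

(* The infimum is attained, see [dist_intP], so this is the minimum. *)
Definition dist_int (R : realType) (x : R) : R :=
  inf (range (fun n : int => `|x - n%:~R|)).

(* [contfrac [:: a_1; ...; a_j]] = 1 / (a_1 + 1 / (... + 1 / a_j)), and 0 on
   the empty sequence. *)
Fixpoint contfrac (R : realType) (s : seq nat) : R :=
  if s is a :: s' then (a%:R + contfrac R s')^-1 else 0.

(* Sequences of partial quotients a_1, a_2, ... are indexed from 1; the value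
   [a 0] is never used. *)
Definition convergent (R : realType) (a : nat -> nat) (j : nat) : R :=
  contfrac R [seq a i | i <- iota 1 j].

Definition is_contfrac (R : realType) (a : nat -> nat) (alpha : R) : Prop :=
  (forall i, (0 < i)%N -> (0 < a i)%N) /\
  (convergent R a @ \oo --> alpha).

(* Denominator q_j of the j-th convergent in lowest terms, see [convergentE]
   and [coprime_cf_num_den]. *)
Fixpoint cf_den (a : nat -> nat) (j : nat) : nat :=
  match j with
  | 0 => 1
  | 1 => a 1
  | (j'.+1 as j1).+1 => a j * cf_den a j1 + cf_den a j'
  end.

Fixpoint cf_num (a : nat -> nat) (j : nat) : nat :=
  match j with
  | 0 => 0
  | 1 => 1
  | (j'.+1 as j1).+1 => a j * cf_num a j1 + cf_num a j'
  end.

Definition recip_sum (R : realType) (alpha : R) (M : nat) : R :=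
  \sum_(1 <= m < M.+1) (dist_int (m%:R * alpha))^-1.

Lemma dist_intP (R : realType) (x : R) :
  (exists n : int, dist_int x = `|x - n%:~R|) /\
  (forall n : int, dist_int x <= `|x - n%:~R|).
Proof.
set E := range (fun n : int => `|x - n%:~R|).
have lbE : has_lbound E by exists 0 => _ [n _ <-].
have le_n (n : int) : dist_int x <= `|x - n%:~R|.
  by apply: ge_inf => //; exists n.
split=> //.
pose f := Num.floor x; have /andP[f1 f2] := floor_itv x.
have f2' : x < f%:~R + 1 by move: f2; rewrite intrD.
have sep (n : int) : n%:~R <= f%:~R :> R \/ f%:~R + 1 <= n%:~R :> R.
  have [lenf|ltfn] := leP n f; first by left; rewrite ler_int.
  by right; rewrite -[X in _ + X]/(1%:~R) -intrD ler_int; lia.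
have [h|h] := leP (x - f%:~R) (f%:~R + 1 - x).
- exists f; apply/eqP; rewrite eq_le le_n /=.
  apply: lb_le_inf; first by exists `|x - f%:~R|; exists f.
  move=> _ [n _ <-]; rewrite (@ger0_norm _ (x - f%:~R)); last by lra.
  have [hn|hn] := sep n.
    by rewrite ger0_norm; lra.
  by rewrite ler0_norm; lra.
- exists (f + 1); apply/eqP; rewrite eq_le le_n /=.
  apply: lb_le_inf; first by exists `|x - f%:~R|; exists f.
  move=> _ [n _ <-]; rewrite intrD (@ler0_norm _ (x - _)); last by lra.
  have [hn|hn] := sep n.
    by rewrite ger0_norm; lra.
  by rewrite ler0_norm; lra.
Qed.

Lemma cf_den_gt0 (a : nat -> nat) (j : nat) :
  (forall i, (0 < i)%N -> (0 < a i)%N) -> (0 < cf_den a j)%N.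
Proof.
move=> a0; suff: (0 < cf_den a j)%N && (0 < cf_den a j.+1)%N by case/andP.
elim: j => [|j /andP[IH1 IH2]]; first by rewrite /= a0.
rewrite IH2 /=; have := a0 j.+2 isT; move: IH1 IH2 => /=; nia.
Qed.

Lemma cf_den_ge (a : nat -> nat) (j : nat) :
  (forall i, (0 < i)%N -> (0 < a i)%N) -> (j <= cf_den a j)%N.
Proof.
move=> a0; suff: (j <= cf_den a j)%N && (j.+1 <= cf_den a j.+1)%N by case/andP.
elim: j => [|j /andP[IH1 IH2]]; first by rewrite /= a0.
rewrite IH2 /=; have := a0 j.+2 isT; have := cf_den_gt0 j a0.
move: IH1 IH2 => /=; nia.
Qed.

Lemma cf_det (R : comPzRingType) (a : nat -> nat) (j : nat) :
  (cf_num a j.+1)%:R * (cf_den a j)%:R - (cf_num a j)%:R * (cf_den a j.+1)%:R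
  = (-1) ^+ j :> R.
Proof.
elim: j => [|j IH]; first by rewrite /= expr0; ring.
rewrite exprS -IH /= !natrD !natrM; ring.
Qed.

Lemma coprime_cf_num_den (a : nat -> nat) (j : nat) :
  coprime (cf_num a j) (cf_den a j).
Proof.
rewrite /coprime -dvdn1.
have := cf_det int a j.
set g := gcdn _ _ => det.
have [gp gq] : (g %| cf_num a j)%N /\ (g %| cf_den a j)%N.
  by split; [exact: dvdn_gcdl|exact: dvdn_gcdr].
have : (g %| ((-1) ^+ j : int))%Z.
  rewrite -det; apply: rpredB; rewrite !natz.
    by apply: dvdz_mull; rewrite dvdzE.
  by apply: dvdz_mulr; rewrite dvdzE.
by rewrite dvdzE abszX /= exp1n.
Qed.

(* Finite continued fraction with a real last term x. *)
Definition contfrac_tail (R : realType) (s : seq nat) (x : R) : R :=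
  foldr (fun a y => (a%:R + y)^-1) x s.

Lemma contfrac_tailS (R : realType) (a : nat -> nat) (j : nat) (x : R) :
  contfrac_tail [seq a i | i <- iota 1 j.+1] x =
  contfrac_tail [seq a i | i <- iota 1 j] ((a j.+1)%:R + x)^-1.
Proof.
by have := iotaD 1 j 1; rewrite addn1 => ->;
  rewrite map_cat /contfrac_tail foldr_cat add1n.
Qed.

Lemma contfrac_tailE (R : realType) (a : nat -> nat) (j : nat) (x : R) :
  (forall i, (0 < i)%N -> (0 < a i)%N) -> 0 <= x ->
  contfrac_tail [seq a i | i <- iota 1 j.+1] x =
  ((cf_num a j.+1)%:R + (cf_num a j)%:R * x) /
  ((cf_den a j.+1)%:R + (cf_den a j)%:R * x).
Proof.
move=> a0; elim: j x => [|j IH] x x0.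
  by rewrite /contfrac_tail /= !mul0r mul1r addr0 mul1r.
have aj : 0 < (a j.+2)%:R :> R by rewrite ltr0n a0.
rewrite contfrac_tailS IH; last first.
  by rewrite invr_ge0 addr_ge0 // ltW.
rewrite [cf_num a j.+2]/(a j.+2 * cf_num a j.+1 + cf_num a j)%N.
rewrite [cf_den a j.+2]/(a j.+2 * cf_den a j.+1 + cf_den a j)%N.
have q1 : 0 < (cf_den a j.+1)%:R :> R by rewrite ltr0n cf_den_gt0.
have q0 : 0 < (cf_den a j)%:R :> R by rewrite ltr0n cf_den_gt0.
move: (cf_num a j.+1) (cf_num a j) (cf_den a j.+1) (cf_den a j) q1 q0.
move=> p1 p0 q1 q0 q1_gt0 q0_gt0; rewrite !natrD !natrM.
field; do ?[apply/andP; split]; apply: lt0r_neq0; nra.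
Qed.

Lemma convergentE (R : realType) (a : nat -> nat) (j : nat) :
  (forall i, (0 < i)%N -> (0 < a i)%N) ->
  convergent R a j = (cf_num a j)%:R / (cf_den a j)%:R.
Proof.
move=> a0; case: j => [|j]; first by rewrite /convergent /= mul0r.
have := @contfrac_tailE R a j 0 a0 (lexx 0); rewrite !mulr0 !addr0 => <-.
by rewrite /convergent; elim: [seq _ | _ <- _] => //= b s ->.
Qed.

(* Every irrational in [0, 1) has a continued fraction expansion. *)
Lemma is_contfrac_exists (R : realType) (alpha : R) :
  0 <= alpha < 1 -> irrational alpha -> exists a, is_contfrac a alpha.
Proof.
move=> /andP[al0 al1] irr.
pose step (t : R) := t^-1 - (Num.truncn t^-1)%:R.
pose t n := iter n step alpha.
pose a i := Num.truncn (t i.-1)^-1.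
have irr0 (x : R) : irrational x -> x != 0.
  by move=> ix; apply/eqP => x0; apply: ix; exists 0 => //; rewrite rmorph0.
have tP n : 0 < t n < 1 /\ irrational (t n).
  elim: n => [|n [/andP[tn0 tn1] itn]].
    by rewrite /t /= lt0r (irr0 _ irr) al0 al1.
  have itS : irrational (t n.+1).
    move=> [q _ qE]; apply: itn; exists (q + (Num.truncn (t n)^-1)%:R)^-1 => //.
    by rewrite fmorphV rmorphD /= qE rmorph_nat /t /= /step subrK invrK.
  split=> //; rewrite lt0r (irr0 _ itS) /=.
  have /truncn_itv/andP[] : 0 <= (t n)^-1 by rewrite invr_ge0 ltW.
  rewrite -natr1 /t /= /step; rewrite -/(t n); lra.
have a0 i : (0 < i)%N -> (0 < a i)%N.
  case: i => // i _; rewrite /a /=; have [/andP[ti0 ti1] _] := tP i.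
  by rewrite truncn_gt0 invf_ge1 // ltW.
have tail n : alpha = contfrac_tail [seq a i | i <- iota 1 n] (t n).
  elim: n => [//|n IH].
  by rewrite contfrac_tailS {1}IH /a /= /step addrC subrK invrK.
exists a; split=> //.
have err n : `|alpha - convergent R a n.+1| <= n.+1%:R^-1.
  rewrite convergentE // (tail n.+1); have [/andP[t0 t1] _] := tP n.+1.
  rewrite contfrac_tailE //; last exact: ltW.
  have q1 : 0 < (cf_den a n.+1)%:R :> R by rewrite ltr0n cf_den_gt0.
  have q0 : 0 < (cf_den a n)%:R :> R by rewrite ltr0n cf_den_gt0.
  have qn : n.+1%:R <= (cf_den a n.+1)%:R :> R by rewrite ler_nat cf_den_ge.
  have q01 : 1 <= (cf_den a n)%:R :> R by rewrite ler1n cf_den_gt0.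
  have det := cf_det R a n.
  have D0 : 0 < (cf_den a n.+1)%:R + (cf_den a n)%:R * t n.+1.
    by rewrite addr_gt0 // mulr_gt0.
  rewrite [X in `|X|](_ : _ = (-1) ^+ n.+1 * (t n.+1 /
      (((cf_den a n.+1)%:R + (cf_den a n)%:R * t n.+1) * (cf_den a n.+1)%:R))).
    rewrite normrM normrX normrN1 expr1n mul1r ger0_norm; last first.
      by rewrite divr_ge0 ?mulr_ge0 // ltW.
    apply: (@le_trans _ _ (cf_den a n.+1)%:R^-1); last first.
      by rewrite lef_pV2 ?posrE // ltr0n.
    rewrite ler_pdivrMr ?mulr_gt0 // mulrCA mulVf ?mulr1 ?gt_eqF //.
    nra.
  rewrite exprS -det; field; apply/andP; split; exact: lt0r_neq0.
apply/cvgrPdist_le => e e0; near=> n.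
have n0 : (0 < n)%N by near: n; exists 1%N.
rewrite -(prednK n0); apply: le_trans (err _) _; rewrite prednK //.
rewrite -[e]invrK lef_pV2 ?posrE ?invr_gt0 ?ltr0n //.
near: n; exists (Num.truncn e^-1).+1 => // m /= hm.
have /truncn_itv/andP[_ /ltW h] : 0 <= e^-1 by rewrite invr_ge0 ltW.
by apply: le_trans h _; rewrite ler_nat.
Unshelve. all: by end_near.
Qed.

(* Main.v *)
Require Import Defs.
From mathcomp Require Import all_boot all_order all_algebra.
From mathcomp Require Import all_classical all_reals all_analysis.
From mathcomp Require Import ring zify.
Import Order.TTheory GRing.Theory Num.Theory.
Import numFieldNormedType.Exports.
Local Open Scope ring_scope.

Set Implicit Arguments.
Unset Strict Implicit.
Unset Printing Implicit Defensive.

(** Let p/q be the k-th convergent. Since |alpha - p/q| <= 1/(q q_{k+1}), every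
    m <= M < q_{k+1} satisfies |m alpha - m p/q| <= 1/q, so that
    ||m alpha|| <= (r + 1)/q where r = m p mod q. Over q consecutive values of
    m, r runs through all the residues modulo q, hence such a block contributes
    at least q (1 + 1/2 + ... + 1/q) >= q log q. There are
    floor(M/q) >= M/(2q) disjoint blocks in [1, M]. *)

Section Residues.
Local Open Scope nat_scope.

Lemma eqn_modMr_coprime (d p m n : nat) : coprime d p ->
  (m * p == n * p %[mod d]) = (m == n %[mod d]).
Proof.
move=> cdp; wlog le_nm : m n / n <= m => [wlog_le|].
  have [|/ltnW] := leqP n m; first exact: wlog_le.
  by rewrite eq_sym [RHS]eq_sym; exact: wlog_le.
by rewrite !eqn_mod_dvd // ?leq_mul2r ?le_nm ?orbT // -mulnBl Gauss_dvdl.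
Qed.

Lemma big_modn_affine (T : Type) (idx : T) (op : Monoid.com_law idx)
    (F : nat -> T) (p q s : nat) : coprime p q ->
  \big[op/idx]_(0 <= i < q) F ((i * p + s) %% q) =
  \big[op/idx]_(0 <= r < q) F r.
Proof.
case: q => [|q] cpq; first by rewrite !big_geq.
pose affine (i : 'I_q.+1) : 'I_q.+1 := inord ((i * p + s) %% q.+1).
have affineE i : affine i = (i * p + s) %% q.+1 :> nat.
  by rewrite inordK // ltn_mod.
have affine_inj : injective affine.
  move=> i j /(congr1 val) /=; rewrite !affineE => /eqP.
  rewrite eqn_modDr eqn_modMr_coprime; last by rewrite coprime_sym.
  by rewrite !modn_small // => /eqP /val_inj.
rewrite !big_mkord [RHS](reindex_inj affine_inj) /=.
by apply: eq_bigr => i _; rewrite affineE.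
Qed.

End Residues.

Lemma ln_le_series_harmonic (R : realType) (n : nat) :
  ln n.+1%:R <= series harmonic n :> R.
Proof.
elim: n => [|n IHn]; first by rewrite ln1 seriesEnat /= big_geq.
have harm_gt0 : 0 < n.+1%:R^-1 :> R by rewrite invr_gt0.
have -> : n.+2%:R = n.+1%:R * (1 + n.+1%:R^-1) :> R.
  by rewrite mulrDr mulr1 divff // natr1.
rewrite lnM ?posrE ?addr_gt0 // seriesSr lerD //.
by apply: le_ln1Dx; apply: lt_trans harm_gt0; rewrite ltrN10.
Qed.

Section DistanceToIntegers.
Variable R : realType.
Implicit Types x y : R.

Lemma dist_int_le x (n : int) : dist_int x <= `|x - n%:~R|.
Proof. by case: (dist_intP x). Qed.

Lemma dist_intD_le x y : dist_int (x + y) <= `|x| + dist_int y.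
Proof.
have [[n ->] _] := dist_intP y.
by apply: le_trans (dist_int_le _ n) _; rewrite -addrA ler_normD.
Qed.

Lemma dist_int_div_le (n q : nat) : (0 < q)%N ->
  dist_int (n%:R / q%:R : R) <= (n %% q)%:R / q%:R.
Proof.
move=> q_gt0; have qR_neq0 : q%:R != 0 :> R by rewrite pnatr_eq0 -lt0n.
suff <- : `|n%:R / q%:R - ((n %/ q)%N : int)%:~R| = (n %% q)%:R / q%:R :> R.
  exact: dist_int_le.
rewrite {1}(divn_eq n q) natrD natrM mulrDl mulfK // -pmulrn addrC addKr.
by rewrite ger0_norm // divr_ge0.
Qed.

Lemma dist_int_gt0 x : irrational x -> 0 < dist_int x.
Proof.
move=> irr_x; have [[n ->] _] := dist_intP x.
rewrite normr_gt0 subr_eq0; apply/eqP => xE; apply: irr_x.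
by exists n%:~R => //; rewrite xE ratr_int.
Qed.

Lemma irrational_natM (m : nat) x :
  (0 < m)%N -> irrational x -> irrational (m%:R * x).
Proof.
move=> m_gt0 irr_x [r _ rE]; apply: irr_x; exists (r / m%:R) => //.
by rewrite fmorph_div /= ratr_nat rE mulrC mulKf // pnatr_eq0 -lt0n.
Qed.

End DistanceToIntegers.

Section Convergents.
Variables (R : realType) (a : nat -> nat).
Hypothesis a_gt0 : forall i, (0 < i)%N -> (0 < a i)%N.

Let den_gt0 (j : nat) : 0 < (cf_den a j)%:R :> R.
Proof. by rewrite ltr0n cf_den_gt0. Qed.

Lemma contfrac_ge0 (s : seq nat) : 0 <= contfrac R s.
Proof. by elim: s => //= b s IHs; rewrite invr_ge0 addr_ge0. Qed.

Lemma contfrac_cat (s t : seq nat) :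
  contfrac R (s ++ t) = contfrac_tail s (contfrac R t).
Proof. by elim: s => //= b s ->. Qed.

Lemma contfrac_tail_sub_convergent (k : nat) (x : R) : 0 <= x ->
  contfrac_tail [seq a i | i <- iota 1 k.+1] x - convergent R a k =
  (-1) ^+ k /
    ((cf_den a k)%:R * ((cf_den a k.+1)%:R + (cf_den a k)%:R * x)).
Proof.
move=> x_ge0; rewrite contfrac_tailE // convergentE // -(cf_det R a k).
by field; rewrite !lt0r_neq0 // ltr_pwDl // mulr_ge0 // ltW.
Qed.

Lemma convergent_dist_le (k n : nat) : (k < n)%N ->
  `|convergent R a n - convergent R a k| <=
  ((cf_den a k)%:R * (cf_den a k.+1)%:R)^-1.
Proof.
move=> lt_kn.
rewrite {1}/convergent -(subnKC lt_kn) iotaD map_cat contfrac_cat.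
set x := contfrac R _; have x_ge0 : 0 <= x by exact: contfrac_ge0.
have den_x_ge0 : 0 <= (cf_den a k)%:R * x by rewrite mulr_ge0 // ltW.
rewrite contfrac_tail_sub_convergent // normrM normrX normrN1 expr1n mul1r.
rewrite ger0_norm ?invr_ge0 ?mulr_ge0 ?addr_ge0 //.
by rewrite lef_pV2 ?posrE ?mulr_gt0 ?ltr_pwDl // ler_pM2l // lerDl.
Qed.

End Convergents.

Lemma contfrac_dist_convergent_le (R : realType) (a : nat -> nat) (alpha : R)
    (k : nat) : is_contfrac a alpha ->
  `|alpha - convergent R a k| <=
  ((cf_den a k)%:R * (cf_den a k.+1)%:R)^-1.
Proof.
move=> [a_gt0 cvg_alpha].
apply: (cvgr_to_le (cvg_norm (cvgB cvg_alpha (cvg_cst (convergent R a k))))).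
by exists k.+1 => // n /= lt_kn; exact: convergent_dist_le.
Qed.

Lemma recip_sumE (R : realType) (alpha : R) (M : nat) :
  recip_sum alpha M = \sum_(0 <= m < M) (dist_int (m.+1%:R * alpha))^-1.
Proof. by rewrite /recip_sum big_add1. Qed.

Section RationalApproximation.
Variables (R : realType) (alpha : R) (p q M : nat).
Hypotheses (alpha_irr : irrational alpha) (q_gt0 : (0 < q)%N).
Hypotheses (coprime_pq : coprime p q).
Hypothesis alpha_near : `|alpha - p%:R / q%:R| <= (q%:R * M%:R)^-1.

Lemma dist_int_natM_gt0 (m : nat) : 0 < dist_int (m.+1%:R * alpha).
Proof. by apply/dist_int_gt0/irrational_natM. Qed.

Lemma recip_sum_nondecreasing :
  {homo recip_sum alpha : m n / (m <= n)%N >-> m <= n}.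
Proof.
move=> m n le_mn; rewrite !recip_sumE [leRHS](big_cat_nat (n := m)) //=.
by rewrite lerDl sumr_ge0 // => i _; rewrite invr_ge0 ltW // dist_int_natM_gt0.
Qed.

Lemma dist_int_le_residue (m : nat) : (m <= M)%N ->
  dist_int (m%:R * alpha) <= ((m * p) %% q).+1%:R / q%:R.
Proof.
move=> le_mM.
have -> : m%:R * alpha = m%:R * (alpha - p%:R / q%:R) + (m * p)%:R / q%:R.
  by rewrite mulrBr mulrA -natrM subrK.
apply: le_trans (dist_intD_le _ _) _; rewrite -nat1r mulrDl mul1r.
apply: lerD; last exact: dist_int_div_le.
rewrite normrM normr_nat; apply: le_trans (ler_wpM2l _ alpha_near) _ => //.
rewrite invfM mulrCA ler_piMr ?invr_ge0 //.
have [->|M_gt0] := posnP M; first by rewrite invr0 mulr0.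
by rewrite ler_pdivrMr ?ltr0n // mul1r ler_nat.
Qed.

Lemma block_recip_sum_ge (s : nat) : (s + q <= M)%N ->
  q%:R * series harmonic q <=
  \sum_(s <= m < s + q) (dist_int (m.+1%:R * alpha))^-1.
Proof.
move=> le_sqM; rewrite -[X in \sum_(X <= _ < _) _]add0n big_addn addKn.
rewrite seriesEnat /= -(big_modn_affine _ _ (s.+1 * p) coprime_pq) mulr_sumr.
apply: ler_sum_nat => i /= lt_iq.
have dist_gt0 := dist_int_natM_gt0 (i + s).
rewrite -[q%:R * _]invrK lef_pV2 ?posrE ?invr_gt0 ?mulr_gt0 ?ltr0n //.
rewrite invfM invrK [leRHS]mulrC -mulnDl addnS.
by apply: dist_int_le_residue; lia.
Qed.

Lemma blocks_recip_sum_ge (b : nat) : (b * q <= M)%N ->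
  b%:R * (q%:R * series harmonic q) <= recip_sum alpha (b * q).
Proof.
move=> le_bqM; rewrite recip_sumE big_nat_mul mulr_natl.
rewrite -[X in _ *+ X]subn0 -sumr_const_nat.
apply: ler_sum_nat => i /= lt_ib; rewrite mulSnr block_recip_sum_ge //.
by rewrite -mulSnr (leq_trans _ le_bqM) // leq_mul2r lt_ib orbT.
Qed.

Lemma recip_sum_ge_ln : (q <= M)%N ->
  2^-1 * M%:R * ln q%:R <= recip_sum alpha M.
Proof.
move=> le_qM.
have le_M_blocks : (M <= 2 * (M %/ q * q))%N.
  have le_q_blocks : (q <= M %/ q * q)%N by rewrite leq_pmull // divn_gt0.
  by have := divn_eq M q; have := ltn_pmod M q_gt0; lia.
apply: le_trans (recip_sum_nondecreasing (leq_divM M q)).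
apply: le_trans (blocks_recip_sum_ge (leq_divM M q)).
rewrite [leRHS]mulrA ler_pM ?mulr_ge0 ?invr_ge0 ?ln_ge0 ?ler1n //.
  by rewrite ler_pdivrMl // -!natrM ler_nat.
apply: le_trans (ln_le_series_harmonic R q).
by rewrite ler_ln ?posrE ?ltr0n // ler_nat.
Qed.

End RationalApproximation.

Theorem theorem3p1 (R : realType) :
  exists c : R, 0 < c /\
    forall (alpha : R) (a : nat -> nat) (M k : nat),
      0 <= alpha < 1 -> irrational alpha -> is_contfrac a alpha ->
      (0 < M)%N ->
      (cf_den a k <= M < cf_den a k.+1)%N ->
      c * M%:R * ln (cf_den a k)%:R <= recip_sum alpha M.
Proof.
exists 2^-1; split; first by rewrite invr_gt0.
move=> alpha a M k _ alpha_irr alpha_cf M_gt0 /andP[le_qM lt_MqS].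
have a_gt0 := alpha_cf.1.
have q_gt0 : (0 < cf_den a k)%N by exact: cf_den_gt0.
apply: (recip_sum_ge_ln alpha_irr q_gt0 (coprime_cf_num_den a k)) le_qM.
rewrite -convergentE //.
apply: le_trans (contfrac_dist_convergent_le k alpha_cf) _.
rewrite lef_pV2 ?posrE ?mulr_gt0 ?ltr0n ?cf_den_gt0 //.
by rewrite ler_pM2l ?ltr0n // ler_nat ltnW.
Qed.
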